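(* Let $P$ be a program and let $(\beta_{\bullet l},\beta_{l\bullet})_{l}$ be the very busy expressions analysis result for $P$. Suppose $i\le j$ and $\langle l_i,\sigma_i\rangle\rightarrow\cdots\rightarrow\langle l_j,\sigma_j\rangle$ is a finite sequence of standard execution steps of $P$ with $l_j:v:=e\in P$. Let $e'\in\beta_{\bullet l_i}$ with $v\in\mathbf{vars}(e')$. Then there exists $k$ with $i\le k\le j$ such that $e'\in\mathbf{subs}(c)$, where $l_k:c\in P$.
   Context: Language. $N$ is the set of integers, $T=\{\mathbf{true},\mathbf{false}\}$, $V$ a set of variables, $L$ a set of labels. Arithmetic expressions $E$: $e::=n\mid v\mid e_0+e_1\mid e_0-e_1\mid e_0\times e_1$ ($n\in N$, $v\in V$). Boolean expressions $B$: $b::=\mathbf{true}\mid\mathbf{false}\mid e_0=e_1\mid e_0\le e_1\mid\mathbf{not}\,b\mid b_0\,\mathbf{and}\,b_1\mid b_0\,\mathbf{or}\,b_1$. Commands: $c::=\mathbf{skip}\mid v:=e\mid\mathbf{if}\,b\,\mathbf{then}\,g\mid\mathbf{goto}\,g\mid\mathbf{halt}\mid\mathbf{done}$ ($g\in L$). $\mathbf{vars}(e)$ is the set of variables occurring in $e$. $\mathbf{subs}(e)\subseteq E$ is the set of subexpressions of $e$ (including $e$ itself); $\mathbf{subs}(b)\subseteq E$ is the set of arithmetic expressions occurring as subexpressions in $b$; for commands, $\mathbf{subs}(v:=e)=\mathbf{subs}(e)$, $\mathbf{subs}(\mathbf{if}\,b\,\mathbf{then}\,g)=\mathbf{subs}(b)$,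 and $\mathbf{subs}(c)=\emptyset$ otherwise. A program $P$ is a sequence of labeled commands $l:c$ with pairwise distinct labels; $\mathbf{next}(l)$ is the label of the command following $l$ in the sequence. If $l:\mathbf{halt}\in P$ then $\mathbf{next}(l):\mathbf{done}\in P$. Branch targets $g$, and $\mathbf{next}(l)$ for each assignment, $\mathbf{skip}$, $\mathbf{if}$ or $\mathbf{halt}$ command at $l$, are labels of $P$. Successors: $\mathbf{succ}(l)=\{\mathbf{next}(l)\}$ for assignment, $\mathbf{skip}$, $\mathbf{halt}$; $\{g\}$ for $\mathbf{goto}\,g$; $\{\mathbf{next}(l),g\}$ for $\mathbf{if}\,b\,\mathbf{then}\,g$. Standard semantics. A state is a partial function $\sigma:V\rightharpoonup N$ with domain $\mathrm{dom}\,\sigma$. The evaluation relations $\langle e,\sigma\rangle\rightarrow n$ and $\langle b,\sigma\rangle\rightarrow t$ are the least relations with: constants evaluate to themselves; $\langle v,\sigma\rangle\rightarrow\sigma(v)$ if $v\in\mathrm{dom}\,\sigma$; a compound expression evaluates to the result of applying its operator to the values of all of its immediate subexpressions, provided all of these evaluate (no short-circuiting). The relation $\langle l,\sigma\rangle\rightarrow\langle l',\sigma'\rangle$ is the least relation with: if $l:v:=e\in P$ and $\langle e,\sigma\rangle\rightarrow n$, then $\langle l,\sigma\rangle\rightarrow\langle\mathbf{next}(l),\sigma[v\mapsto n]\rangle$; if $l:\mathbf{if}\,b\,\mathbf{then}\,g\in P$, then $\langle l,\sigma\rangle\rightarrow\langle g,\sigma\rangle$ when $\langle b,\sigma\rangle\rightarrow\mathbf{true}$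 and $\langle l,\sigma\rangle\rightarrow\langle\mathbf{next}(l),\sigma\rangle$ when $\langle b,\sigma\rangle\rightarrow\mathbf{false}$; if $l:\mathbf{goto}\,g\in P$, then $\langle l,\sigma\rangle\rightarrow\langle g,\sigma\rangle$; if $l:\mathbf{skip}\in P$, or $l:\mathbf{halt}\in P$ and $\mathbf{next}(l):\mathbf{done}\in P$, then $\langle l,\sigma\rangle\rightarrow\langle\mathbf{next}(l),\sigma\rangle$. Very busy expressions analysis. $\beta_{\bullet l},\beta_{l\bullet}\subseteq E$, for $l$ ranging over the labels of $P$, are the least solution with respect to componentwise reverse inclusion $\supseteq$ (i.e. the solution with the largest sets) of the equations: $\beta_{l\bullet}=\emptyset$ if $l:\mathbf{done}\in P$; $\beta_{l\bullet}=\bigcap_{g\in\mathbf{succ}(l)}\beta_{\bullet g}$ for all other labels $l$; $\beta_{\bullet l}=f(l,\beta_{l\bullet})$, where $f(l,\beta)=(\beta\setminus\{e'\in\beta: v\in\mathbf{vars}(e')\})\cup\mathbf{subs}(e)$ if $l:v:=e\in P$, $f(l,\beta)=\beta\cup\mathbf{subs}(b)$ if $l:\mathbf{if}\,b\,\mathbf{then}\,g\in P$, and $f(l,\beta)=\beta$ otherwise. *)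

(* Defs.v *)
From HB Require Import structures.
From mathcomp Require Import all_boot all_order all_algebra.
From mathcomp Require Import boolp classical_sets.

Set Implicit Arguments.
Unset Strict Implicit.
Unset Printing Implicit Defensive.

Import Order.TTheory GRing.Theory Num.Theory.

Local Open Scope classical_set_scope.
Local Open Scope ring_scope.

Inductive expr (V : Type) : Type :=
  | Num of int
  | Var of V
  | Add of expr V & expr V
  | Sub of expr V & expr V
  | Mul of expr V & expr V.

Arguments Num {V}.

Inductive bexpr (V : Type) : Type :=
  | BTrue
  | BFalse
  | BEq of expr V & expr V
  | BLe of expr V & expr V
  | BNot of bexpr V
  | BAnd of bexpr V & bexpr V
  | BOr of bexpr V & bexpr V.

Arguments BTrue {V}.
Arguments BFalse {V}.

Inductive command (V L : Type) : Type :=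
  | Skip
  | Assign of V & expr V
  | If of bexpr V & L
  | Goto of L
  | Halt
  | Done.

Arguments Skip {V L}.
Arguments Assign {V L}.
Arguments If {V L}.
Arguments Goto {V L}.
Arguments Halt {V L}.
Arguments Done {V L}.

(* Classical equality, so that [(l, c) \in P] makes sense for a program [P]. *)
HB.instance Definition _ (V L : Type) := gen_eqMixin (command V L).

Fixpoint vars (V : Type) (e : expr V) : set V :=
  match e with
  | Num _ => set0
  | Var v => [set v]
  | Add e0 e1 | Sub e0 e1 | Mul e0 e1 => vars e0 `|` vars e1
  end.

Fixpoint subs (V : Type) (e : expr V) : set (expr V) :=
  [set e] `|`
  match e with
  | Num _ | Var _ => set0
  | Add e0 e1 | Sub e0 e1 | Mul e0 e1 => subs e0 `|` subs e1
  end.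

Fixpoint bsubs (V : Type) (b : bexpr V) : set (expr V) :=
  match b with
  | BTrue | BFalse => set0
  | BEq e0 e1 | BLe e0 e1 => subs e0 `|` subs e1
  | BNot b0 => bsubs b0
  | BAnd b0 b1 | BOr b0 b1 => bsubs b0 `|` bsubs b1
  end.

Definition csubs (V L : Type) (c : command V L) : set (expr V) :=
  match c with
  | Assign _ e => subs e
  | If b _ => bsubs b
  | _ => set0
  end.

Definition program (V L : eqType) := seq (L * command V L).

Section Programs.
Variables V L : eqType.
Implicit Types (P : program V L) (l : L) (c : command V L).

Definition labels P : seq L := [seq lc.1 | lc <- P].

(* [None] when [l] is the last label of [P] or not a label of [P]. *)
Definition next_label P l : option L :=
  onth (labels P) (index l (labels P)).+1.

Definition falls_through c : bool :=
  match c with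
  | Skip | Assign _ _ | If _ _ | Halt => true
  | Goto _ | Done => false
  end.

Definition branch_target c : option L :=
  match c with
  | If _ g | Goto g => Some g
  | _ => None
  end.

Record wf_program P : Prop := WfProgram {
  wf_uniq : uniq (labels P);
  wf_next : forall l c, (l, c) \in P -> falls_through c ->
    exists2 l', next_label P l = Some l' & l' \in labels P;
  wf_target : forall l c g, (l, c) \in P -> branch_target c = Some g ->
    g \in labels P;
  wf_halt : forall l, (l, Halt) \in P ->
    exists2 l', next_label P l = Some l' & (l', Done) \in P
}.

(* Here [c] is meant to be the command of [P] labeled [l]. *)
Definition succ P l c : set L :=
  match c with
  | Assign _ _ | Skip | Halt => [set l' | next_label P l = Some l']
  | Goto g => [set g]
  | If _ g => [set l' | next_label P l = Some l'] `|` [set g]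
  | Done => set0
  end.

Definition state := V -> option int.

Definition update (s : state) (v : V) (n : int) : state :=
  fun w => if w == v then Some n else s w.

Inductive eval (s : state) : expr V -> int -> Prop :=
  | eval_num n : eval s (Num n) n
  | eval_var v n : s v = Some n -> eval s (Var v) n
  | eval_add e0 e1 n0 n1 : eval s e0 n0 -> eval s e1 n1 ->
      eval s (Add e0 e1) (n0 + n1)
  | eval_sub e0 e1 n0 n1 : eval s e0 n0 -> eval s e1 n1 ->
      eval s (Sub e0 e1) (n0 - n1)
  | eval_mul e0 e1 n0 n1 : eval s e0 n0 -> eval s e1 n1 ->
      eval s (Mul e0 e1) (n0 * n1).

Inductive beval (s : state) : bexpr V -> bool -> Prop :=
  | beval_true : beval s BTrue true
  | beval_false : beval s BFalse false
  | beval_eq e0 e1 n0 n1 : eval s e0 n0 -> eval s e1 n1 ->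
      beval s (BEq e0 e1) (n0 == n1)
  | beval_le e0 e1 n0 n1 : eval s e0 n0 -> eval s e1 n1 ->
      beval s (BLe e0 e1) (n0 <= n1)
  | beval_not b t : beval s b t -> beval s (BNot b) (~~ t)
  | beval_and b0 b1 t0 t1 : beval s b0 t0 -> beval s b1 t1 ->
      beval s (BAnd b0 b1) (t0 && t1)
  | beval_or b0 b1 t0 t1 : beval s b0 t0 -> beval s b1 t1 ->
      beval s (BOr b0 b1) (t0 || t1).

Inductive step P : L * state -> L * state -> Prop :=
  | step_assign l l' s v e n :
      (l, Assign v e) \in P -> eval s e n -> next_label P l = Some l' ->
      step P (l, s) (l', update s v n)
  | step_if_true l s b g :
      (l, If b g) \in P -> beval s b true -> step P (l, s) (g, s)
  | step_if_false l l' s b g :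
      (l, If b g) \in P -> beval s b false -> next_label P l = Some l' ->
      step P (l, s) (l', s)
  | step_goto l s g :
      (l, Goto g) \in P -> step P (l, s) (g, s)
  | step_skip l l' s :
      (l, Skip) \in P -> next_label P l = Some l' -> step P (l, s) (l', s)
  | step_halt l l' s :
      (l, Halt) \in P -> next_label P l = Some l' -> (l', Done) \in P ->
      step P (l, s) (l', s).

Definition transfer c (B : set (expr V)) : set (expr V) :=
  match c with
  | Assign v e => (B `\` [set e' | vars e' v]) `|` subs e
  | If b _ => B `|` bsubs b
  | _ => B
  end.

(* [bin l] and [bout l] are the sets at the entry and at the exit of [l]; their
   values are constrained only at the labels of [P]. *)
Definition vbe_solution P (bin bout : L -> set (expr V)) : Prop :=
  forall l c, (l, c) \in P ->
    bout l = (if c is Done then set0 else \bigcap_(g in succ P l c) bin g) /\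
    bin l = transfer c (bout l).

(* Least for reverse inclusion, hence with the largest sets. *)
Definition vbe_analysis P (bin bout : L -> set (expr V)) : Prop :=
  vbe_solution P bin bout /\
  forall bin' bout', vbe_solution P bin' bout' ->
    forall l, l \in labels P -> bin' l `<=` bin l /\ bout' l `<=` bout l.

End Programs.

(* Main.v *)
(** Every element of the transferred set either occurs in the command or was
    already in the set at the exit, which is contained in the entry set of each
    successor. So [e'] stays very busy along the execution until a command
    containing it is met; at the latest this happens at [l j], because the
    assignment to [v] kills [e']. *)

Require Import Defs.
From mathcomp Require Import all_boot all_order all_algebra.
From mathcomp Require Import boolp classical_sets.

(** Recording [c <> Done] selects the case of the equations in which the exit set is an intersection
    over successors. *)
Lemma step_succ (V L : eqType) (P : program V L) (x y : L * state V) :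
  step P x y ->
  exists c : command V L, [/\ (x.1, c) \in P, c <> Done & succ P x.1 c y.1].
Proof.
by case=> [l l' s v e n Pl _ Hn|l s b g Pl _|l l' s b g Pl _ Hn|l s g Pl
  |l l' s Pl Hn|l l' s Pl Hn _]; eexists; (split; first exact: Pl) => //=;
  [right|left].
Qed.

Lemma transfer_sub (V L : eqType) (c : command V L) (B : set (expr V)) :
  (transfer c B `<=` B `|` csubs c)%classic.
Proof.
by case: c => [|w e|b g|g||] /= x; [left|case=> [[]|]; [left|right]| |left..].
Qed.

Lemma vbe_step {V L : eqType} {P : program V L} {bin bout : L -> set (expr V)}
    {x y : L * state V} {e' : expr V} :
  vbe_solution P bin bout -> step P x y -> bin x.1 e' ->
  bin y.1 e' \/ exists2 c, (x.1, c) \in P & csubs c e'.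
Proof.
move=> sol /step_succ[c [Pc cD sc]]; have [bo ->] := sol _ _ Pc.
case/transfer_sub => [|ce']; last by right; exists c.
(* The intersection is instantiated at [y.1], the successor actually taken. *)
rewrite bo; case: c cD sc {Pc bo} => // [|w e|b g|g|] _ sc be; left; exact: be.
Qed.

Theorem theorem4p18 (V L : eqType) (P : program V L)
    (bin bout : L -> set (expr V)) (l : nat -> L) (sigma : nat -> state V)
    (i j : nat) (v : V) (e e' : expr V) :
  wf_program P ->
  vbe_analysis P bin bout ->
  (i <= j)%N ->
  (forall k : nat, (i <= k < j)%N ->
     step P (l k, sigma k) (l k.+1, sigma k.+1)) ->
  (l j, Assign v e) \in P ->
  bin (l i) e' ->
  vars e' v ->
  exists (k : nat) (c : command V L),
    [/\ (i <= k <= j)%N, (l k, c) \in P & csubs c e'].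
Proof.
move=> _ [sol _] le_ij steps Pj bi ve'.
have [n] : exists n, j - i = n by exists (j - i).
(* Induction on the number of remaining steps: the start [i] varies while the end [j] stays
   fixed. *)
elim: n i le_ij steps bi => [|n IHn] i le_ij steps bi ji.
  have ij : i = j by apply/eqP; rewrite eqn_leq le_ij -subn_eq0 ji.
  rewrite ij in bi *; exists j, (Assign v e); split; rewrite ?leqnn //.
  (* Since [vars e' v], the surviving part of the exit set cannot contain [e']; only [subs e] is
     left. *)
  have [_] := sol _ _ Pj; move: bi => /[swap] -> /=.
  by case=> // -[_ []].
have lt_ij : i < j by rewrite -subn_gt0 ji.
have step_i : step P (l i, sigma i) (l i.+1, sigma i.+1).
  by apply: steps; rewrite leqnn.
have [bi1|[c Pc ce']] := vbe_step sol step_i bi.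
  have [k /andP[ik kj]||k [c [/andP[ik kj] Pc ce']]] := IHn i.+1 lt_ij _ bi1.
  - by apply: steps; rewrite kj ltnW.
  - by rewrite subnS ji.
  - by exists k, c; split=> //; rewrite kj ltnW.
(* Here [e'] already occurs in the command at [l i], so the witness is [i] itself. *)
by exists i, c; rewrite leqnn le_ij.
Qed.
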